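(* Let $C_{n,1}$ be the number of comparisons made by Quickselect to find the smallest element of a list of $n$ distinct numbers, and let $W_{n,1}=\frac{1}{n}C_{n,1}-1$. Let $D$ have the standard Dickman distribution. Then for all $n\ge 1$, $$d_1(W_{n,1},D)\le \frac{8\log(n/2)+10}{n}.$$
   Context: Quickselect (to find the $m$-th smallest element of a list of $n\ge m$ distinct numbers): a pivot is chosen uniformly at random from the list and compared with each of the other $n-1$ elements; the elements smaller than the pivot form the left sublist and those larger form the right sublist. If the left sublist has size $m-1$, the pivot is the answer and the procedure stops; if it has size $\ge m$, the procedure recurses on the left sublist to find its $m$-th smallest element; otherwise (left size $L<m-1$) it recurses on the right sublist to find its $(m-L-1)$-th smallest element. All pivot choices are independent. $C_{n,m}$ denotes the total number of comparisons made (a random variable whose law depends only on $n,m$). The standard Dickman distribution is the unique law of a non-negative random variable $D$ satisfying $D=_d U(D+1)$, where $U\sim\mathcal U[0,1]$ is independent of $D$. The Wasserstein distance is $d_1(X,Y)=\sup_{h\in \mathrm{Lip}_1}|Eh(X)-Eh(Y)|$, where $\mathrm{Lip}_1=\{h:|h(y)-h(x)|\le|y-x|\}$. *)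

(* Defs.v *)
From HB Require Import structures.
From mathcomp Require Import all_boot all_order all_algebra.
From mathcomp Require Import all_classical all_reals all_analysis.
Set Implicit Arguments. Unset Strict Implicit. Unset Printing Implicit Defensive.
Import Order.TTheory GRing.Theory Num.Theory.
Local Open Scope classical_set_scope.
Local Open Scope ring_scope.

(* Law of the Quickselect comparison count, given through its expectation
   functional: [qs_exp_fuel fuel n m g] = E[ g (C_{n,m}) ] (for n <= fuel).
   One step: the pivot is uniform, so the left sublist size L is uniform on
   {0,...,n-1}; n-1 comparisons are made; then
   - L = m-1: stop;
   - L >= m : recurse on (L, m);
   - L < m-1: recurse on (n-1-L, m-L-1). *)
Fixpoint qs_exp_fuel (R : realType) (fuel n m : nat) (g : nat -> R) : R :=
  match fuel with
  | 0%N => 0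
  | fuel'.+1 =>
      (n%:R)^-1 * \sum_(L < n)
        (if L == m.-1 :> nat then g n.-1
         else if (m <= L)%N then qs_exp_fuel fuel' L m (fun c => g (c + n.-1)%N)
         else qs_exp_fuel fuel' (n.-1 - L) (m - L.+1) (fun c => g (c + n.-1)%N))
  end.

(* E[ g (C_{n,m}) ] for 1 <= m <= n *)
Definition qs_exp (R : realType) (n m : nat) (g : nat -> R) : R :=
  qs_exp_fuel n n m g.

Definition lip1 (R : realType) (h : R -> R) : Prop :=
  forall x y : R, `|h y - h x| <= `|y - x|.

(* mu is the standard Dickman law: a law on [0,oo) with D =_d U (D + 1),
   U ~ Unif[0,1] independent of D, i.e. mu is the image of
   Unif[0,1] (x) mu under (u, x) |-> u (x + 1). *)
Definition is_dickman (R : realType) (mu : probability R R) : Prop :=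
  mu [set x : R | x < 0] = 0%E /\
  forall A : set R, measurable A ->
    mu A = (\int[@lebesgue_measure R]_(u in `[0%R, 1%R]%classic)
              mu ((fun x : R => (u : R) * (x + 1))%R @^-1` A))%E.

(* Main.v *)
Require Import Defs.
From HB Require Import structures.
From mathcomp Require Import all_boot all_order all_algebra.
From mathcomp Require Import all_classical all_reals all_analysis.
From mathcomp Require Import measurable_realfun ring lra.
Import Order.TTheory GRing.Theory Num.Theory.
Import numFieldNormedType.Exports.
Local Open Scope classical_set_scope.
Local Open Scope ring_scope.

(* W_n satisfies W_n = (L/n)(W_L + 1) - 1/n with L uniform on {0, ..., n-1},
   while D = U(D + 1).  Coupling L = floor(nU) gives, for d_n the distance
   between the laws of W_n and D,
     d_n <= 1/n + (E|D| + 1)/n + (1/n) sum_(L < n) (L/n) d_L,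
   and since E|D| <= 1 the induction closes with d_n <= 3 H_n / n, which is at
   most 3 (1 + ln n) / n.  The argument is run on test functions: the integral
   over U is cut into the intervals [L/n, (L+1)/n].  That E|D| is finite is not
   part of the definition of D; it follows by integrating a truncation of |x|
   against the fixed-point equation. *)

(** * The Dickman fixed-point equation on test functions *)

Lemma integral_uniform01 (R : realType) (f : R -> \bar R) :
  measurable_fun setT f ->
  (\int[uniform_prob (@ltr01 R)]_u f u =
   \int[lebesgue_measure]_(u in `[0%R, 1%R]) f u)%E.
Proof.
move=> mf; rewrite [LHS]integralE [RHS]integralE !integral_uniform //=.
- by rewrite subr0 invr1 !mul1e.
- exact: measurable_funeneg.
- exact: measurable_funepos.
Qed.

Lemma integrable_uniform01 (R : realType) (f : R -> \bar R) :
  (uniform_prob (@ltr01 R)).-integrable setT f ->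
  (@lebesgue_measure R).-integrable `[0, 1] f.
Proof.
move=> /integrableP[mf foo]; apply/integrableP; split.
  exact: measurable_funTS.
by rewrite -integral_uniform01 //; exact: measurableT_comp.
Qed.

Section dickman_fixpoint.
Context (R : realType) (mu : probability R R).
Hypothesis mu_dickman : is_dickman mu.

Let phi (z : R * R) : R := z.1 * (z.2 + 1).

Let measurable_phi : measurable_fun setT phi.
Proof.
apply: measurable_funM; first exact: measurable_fst.
by apply: measurable_funD; [exact: measurable_snd|exact: measurable_cst].
Qed.

Let P := uniform_prob (@ltr01 R).

(** The integral in [is_dickman] is the product measure of the preimage of [A] under [phi], computed
    by its sections at fixed [u]. Modelling U by the probability [P] on all of [R] makes [P \x mu]
    the joint law of (U, D). *)
Let dickman_pushforward (A : set R) : measurable A ->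
  mu A = pushforward (P \x mu)%E phi A.
Proof.
move=> mA; have mphiA : measurable (phi @^-1` A).
  by rewrite -[X in measurable X]setTI; exact: measurable_phi.
rewrite (mu_dickman.2 _ mA) /pushforward /= /product_measure1 /=.
rewrite integral_uniform01; last exact: measurable_fun_xsection.
apply: eq_integral => u _ /=; congr (mu _).
by apply/seteqP; split => x /=; rewrite /xsection /= inE.
Qed.

(** Change of variables along [phi], then Fubini. The second hypothesis makes the inner integral
    finite at every [u], not merely almost every [u], so that it can be taken real-valued. *)
Lemma dickman_fixpoint (f : R -> R) :
    mu.-integrable setT (EFin \o f) ->
    (forall u, mu.-integrable setT (fun x => (f (u * (x + 1)))%:E)) ->
  (@lebesgue_measure R).-integrable `[0, 1]
     (fun u => (\int[mu]_x f (u * (x + 1)))%:E) /\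
  \int[mu]_x f x =
    \int[lebesgue_measure]_(u in `[0, 1]) \int[mu]_x f (u * (x + 1)).
Proof.
move=> intf intfu.
have mf : measurable_fun setT (EFin \o f) by apply: measurable_int intf.
have int_phi : (P \x mu)%E.-integrable setT ((EFin \o f) \o phi).
  apply/integrableP; split; first exact: measurableT_comp.
  have /integrableP[_] := intf.
  rewrite (eq_measure_integral (pushforward (P \x mu)%E phi)); last first.
    by move=> A mA _; exact: dickman_pushforward.
  rewrite ge0_integral_pushforward //.
  exact: measurableT_comp.
have FE : fubini_F mu ((EFin \o f) \o phi) =
          fun u => (\int[mu]_x f (u * (x + 1)))%:E.
  apply/funext => u; rewrite /fubini_F /Rintegral fineK //=.
  exact: integrable_fin_num.
have intF : P.-integrable setT (fun u => (\int[mu]_x f (u * (x + 1)))%:E).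
  by rewrite -FE; exact: integrable_fubini_F.
split; first exact: integrable_uniform01.
congr fine; rewrite (eq_measure_integral (pushforward (P \x mu)%E phi)); last first.
  by move=> A mA _; exact: dickman_pushforward.
rewrite integral_pushforward //= preimage_setT -integral12_prod_meas1 //.
rewrite [X in (\int[_]_x X x)%E]FE integral_uniform01 //; exact: (measurable_int _ intF).
Qed.

End dickman_fixpoint.

(** * Integrability of real-valued functions *)

Section integrable_EFin.
Context d (T : measurableType d) (R : realType).
Variables (mu : {measure set T -> \bar R}) (D : set T).
Hypothesis mD : measurable D.
Implicit Types f g : T -> R.

Lemma integrable_EFinD f g :
  mu.-integrable D (EFin \o f) -> mu.-integrable D (EFin \o g) ->
  mu.-integrable D (fun x => (f x + g x)%:E).
Proof. exact: integrableD. Qed.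

Lemma integrable_EFinB f g :
  mu.-integrable D (EFin \o f) -> mu.-integrable D (EFin \o g) ->
  mu.-integrable D (fun x => (f x - g x)%:E).
Proof. exact: integrableB. Qed.

Lemma integrable_EFinZ f (r : R) :
  mu.-integrable D (EFin \o f) -> mu.-integrable D (fun x => (r * f x)%:E).
Proof. exact: integrableZl. Qed.

End integrable_EFin.

Lemma integrable_continuous_unit (R : realType) (f : R -> R) :
  continuous f -> (@lebesgue_measure R).-integrable `[0, 1] (EFin \o f).
Proof.
move=> cf; apply: continuous_compact_integrable; first exact: segment_compact.
exact: continuous_subspaceT.
Qed.

Lemma Rintegral_probability_cst d (T : measurableType d) (R : realType)
  (mu : probability T R) (c : R) : \int[mu]_x c = c.
Proof. by rewrite Rintegral_cst // [X in _ * fine X]probability_setT mulr1. Qed.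

Lemma bounded_integrable d (T : measurableType d) (R : realType)
    (mu : probability T R) (f : T -> R) (B : R) :
  measurable_fun setT f -> (forall x, `|f x| <= B) ->
  mu.-integrable setT (EFin \o f).
Proof.
move=> mf fB; apply: (@le_integrable _ _ _ _ _ measurableT _ (cst B%:E)).
- exact/measurable_EFinP.
- by move=> x _; rewrite /= lee_fin (le_trans (fB x)) // ler_norm.
- exact: finite_measure_integrable_cst.
Qed.

(** * The Dickman law has finite mean, at most 1 *)

Section dickman_mean.
Context (R : realType) (mu : probability R R).
Hypothesis mu_dickman : is_dickman mu.

(** Two truncations are used because [cap] goes through the fixed-point equation and must cancel,
    while [trunc] records the gain. Beyond [M] the capped value need not shrink when [x] is replaced
    by [u * (x + 1)], so there the gain is set to 0. *)
Let cap (M x : R) : R := Num.min `|x| M.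
Let trunc (M x : R) : R := if `|x| <= M then `|x| else 0.

Let measurable_cap M : measurable_fun setT (cap M).
Proof.
by apply: measurable_minr; [exact: normr_measurable|exact: measurable_cst].
Qed.

Let measurable_trunc M : measurable_fun setT (trunc M).
Proof.
by apply: measurable_fun_ifT => //; exact: measurable_fun_ler.
Qed.

Let cap_bounded M x : 0 <= M -> `|cap M x| <= M.
Proof.
move=> M0; rewrite ger0_norm /cap ?le_min ?normr_ge0 //.
by rewrite ge_min lexx orbT.
Qed.

Let trunc_ge0 M x : 0 <= trunc M x.
Proof. by rewrite /trunc; case: ifP. Qed.

Let trunc_bounded M x : 0 <= M -> `|trunc M x| <= M.
Proof. by move=> M0; rewrite ger0_norm // /trunc; case: ifP. Qed.

(* A truncated form of [|u (x + 1)| <= |x| - (1 - u) |x| + u], with both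
   truncations bounded, so that it can be integrated against mu before
   the mean is known to be finite. *)
Let cap_step (M x u : R) : 0 <= M -> 0 <= u <= 1 ->
  cap M (u * (x + 1)) <= cap M x + 1 - (1 - u) * (trunc M x + 1).
Proof.
move=> M0 /andP[u0 u1]; rewrite /cap /trunc.
have ux : `|u * (x + 1)| <= u * (`|x| + 1).
  by rewrite normrM (ger0_norm u0) ler_wpM2l // -[X in _ <= _ + X]normr1 ler_normD.
case: ifPn => [xM|]; last rewrite -ltNge => Mx.
  rewrite ge_min (min_idPl _) //; apply/orP; left; nra.
rewrite (min_idPr (ltW Mx)) ge_min; apply/orP; right; lra.
Qed.

Let integrable_trunc M : 0 <= M -> mu.-integrable setT (EFin \o trunc M).
Proof.
move=> M0; apply: (@bounded_integrable _ _ _ _ _ M) => [//|x].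
exact: trunc_bounded.
Qed.

(** Integrating [cap_step] over [x] and then over [u] gives [a <= a + 1 - (b + 1) / 2], where 1/2 is
    the integral of [1 - u]. Since [a] is finite it cancels, leaving [b <= 1]. *)
Let trunc_mean M : 0 <= M -> \int[mu]_x trunc M x <= 1.
Proof.
move=> M0.
have icap u v : mu.-integrable setT (fun x => (cap M (u * (x + v)))%:E).
  apply: (@bounded_integrable _ _ _ _ _ M) => [|x]; last exact: cap_bounded.
  apply: measurableT_comp => //; apply: measurable_funM => //.
  exact: measurable_funD.
have icap0 : mu.-integrable setT (EFin \o cap M).
  by apply: (@bounded_integrable _ _ _ _ _ M) => [//|x]; exact: cap_bounded.
have itrunc : mu.-integrable setT (EFin \o trunc M).
  exact: integrable_trunc.
have icst (c : R) : mu.-integrable setT (EFin \o cst c).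
  exact: finite_measure_integrable_cst.
have [iF capE] := dickman_fixpoint _ _ mu_dickman _ icap0 (icap ^~ 1).
set a := \int[mu]_x cap M x in capE *; set b := \int[mu]_x trunc M x.
have Fle u : `[0, 1]%classic u ->
    \int[mu]_x cap M (u * (x + 1)) <= a + 1 - (1 - u) * (b + 1).
  rewrite /= in_itv /= => u01.
  have icap1 : mu.-integrable setT (fun x => (cap M x + 1)%:E).
    by apply: integrable_EFinD => //; exact: icst.
  have itrunc1 : mu.-integrable setT (fun x => (trunc M x + 1)%:E).
    by apply: integrable_EFinD => //; exact: icst.
  have itrunc1u := integrable_EFinZ _ _ _ _ _ measurableT _ (1 - u) itrunc1.
  have -> : a + 1 - (1 - u) * (b + 1) =
      \int[mu]_x (cap M x + 1 - (1 - u) * (trunc M x + 1)).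
    rewrite RintegralB // (RintegralZl _ _ itrunc1) //.
    rewrite (RintegralD _ icap0 (icst 1)) // (RintegralD _ itrunc (icst 1)) //.
    by rewrite !Rintegral_probability_cst.
  apply: le_Rintegral => //.
  - exact: icap.
  - exact: integrable_EFinB.
  - by move=> x _; exact: cap_step.
have i1u : (@lebesgue_measure R).-integrable `[0, 1]
    (EFin \o (fun u : R => 1 - u)).
  apply: integrable_continuous_unit => u.
  by apply: cvgB; [exact: cvg_cst|exact: cvg_id].
have i1 (c : R) : (@lebesgue_measure R).-integrable `[0, 1] (EFin \o cst c).
  by apply: integrable_continuous_unit => u; exact: cvg_cst.
have i1ub : (@lebesgue_measure R).-integrable `[0, 1]
    (fun u : R => ((b + 1) * (1 - u))%:E) by exact: integrable_EFinZ.
have : a <= a + 1 - (b + 1) / 2.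
  rewrite {1}capE.
  have -> : a + 1 - (b + 1) / 2 =
     \int[lebesgue_measure]_(u in `[0, 1]) (a + 1 - (b + 1) * (1 - u)).
    rewrite (RintegralB _ (i1 (a + 1)) i1ub) // (RintegralZl _ _ i1u) //.
    rewrite Rintegral_cst //= lebesgue_measure_itv /= lte_fin ltr01 -EFinB /= subr0 mulr1.
    by have := @Rintegral_onemXn R 1 => ->.
  apply: le_Rintegral => //; last first.
    by move=> u u01; rewrite (mulrC (b + 1)); exact: Fle.
  by apply: integrable_EFinB => //; exact: i1.
lra.
Qed.

Let mean_norm_le1 : (\int[mu]_x (`|x|)%:E <= 1)%E.
Proof.
(* For fixed [x] the truncation equals [|x|] as soon as [n] exceeds it, and it is nondecreasing in
   [n]; monotone convergence then carries the uniform bound to the mean. *)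
have truncE (x : R) : limn (fun n => (trunc n%:R x)%:E) = (`|x|)%:E.
  apply: lim_near_cst => //; near=> n; rewrite /trunc ifT //.
  by near: n; exact: nbhs_infty_ger.
rewrite (eq_integral (fun x => limn (fun n => (trunc n%:R x)%:E))); last first.
  by move=> x _; rewrite truncE.
have mono (x : R) : {homo (fun n => (trunc n%:R x)%:E) : m n / (m <= n)%N >-> (m <= n)%E}.
  move=> m k mk; rewrite lee_fin /trunc; case: ifPn => [xm|_]; last by case: ifP.
  by rewrite ifT // (le_trans xm) // ler_nat.
have mtrunc n : measurable_fun setT (fun x => (trunc n%:R x)%:E).
  by apply/measurable_EFinP; exact: measurable_trunc.
have trunc0 n (x : R) : setT x -> (0 <= (trunc n%:R x)%:E)%E by rewrite lee_fin.
rewrite monotone_convergence //.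
apply: lime_le.
  by apply: (cvgP _ (cvg_monotone_convergence _ mtrunc trunc0 _)).
near=> n; rewrite -[leLHS]fineK; first by rewrite lee_fin; exact: trunc_mean.
exact/integrable_fin_num/integrable_trunc.
Unshelve. all: by end_near. Qed.

Lemma dickman_integrable : mu.-integrable setT (EFin \o id).
Proof.
apply/integrableP; split; first exact/measurable_EFinP.
exact: (le_lt_trans mean_norm_le1 (ltry _)).
Qed.

Lemma dickman_mean_le1 : \int[mu]_x `|x| <= 1.
Proof.
rewrite -lee_fin fineK ?mean_norm_le1 //.
exact/integrable_fin_num/(integrable_norm dickman_integrable).
Qed.

End dickman_mean.

(** * Integrals compared with averages over a uniform grid *)

Lemma Rintegral_step_approx (R : realType) (G : R -> R) (c : nat -> R)
    (B : R) (n : nat) :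
  (0 < n)%N ->
  (@lebesgue_measure R).-integrable `[0, 1] (EFin \o G) ->
  (forall L u, L%:R / n%:R <= u -> u <= L.+1%:R / n%:R -> `|G u - c L| <= B) ->
  `|\int[lebesgue_measure]_(u in `[0, 1]) G u - n%:R^-1 * \sum_(L < n) c L|
    <= B.
Proof.
move=> n0 iG GB.
have n0' : 0 < n%:R :> R by rewrite ltr0n.
have iGk k : (k <= n)%N ->
    (@lebesgue_measure R).-integrable `[0, k%:R / n%:R[ (EFin \o G).
  move=> kn; apply: integrableS iG => // u /=; rewrite !in_itv /=.
  move=> /andP[-> /ltW /le_trans]; apply.
  by rewrite ler_pdivrMr // mul1r ler_nat.
(* Induction on the number of cells, each of length 1/n and hence contributing at most B/n.
   Half-open cells keep the pieces disjoint; the endpoint 1 is restored at the end as a null set. *)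
suff step k : (k <= n)%N ->
    `|\int[lebesgue_measure]_(u in `[0, k%:R / n%:R[) G u
      - n%:R^-1 * \sum_(L < k) c L| <= k%:R / n%:R * B.
  have := step n (leqnn n).
  by rewrite divff ?gt_eqF // mul1r Rintegral_itv_bndo_bndc //;
     apply: integrableS iG => // u /=; rewrite !in_itv /= => /andP[-> /ltW].
elim: k => [_|k IH kn].
  by rewrite mul0r set_itvco0 Rintegral_set0 big_ord0 mulr0 subrr normr0 mul0r.
have knk : k%:R / n%:R <= k.+1%:R / n%:R :> R.
  by rewrite ler_pM2r ?invr_gt0 // ler_nat.
have k0 : 0 <= k%:R / n%:R :> R by rewrite divr_ge0.
have ksub : `[k%:R / n%:R, k.+1%:R / n%:R[ `<=` `[(0:R), k.+1%:R / n%:R[.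
  by apply: subset_itvr; rewrite bnd_simp.
have iGkk : (@lebesgue_measure R).-integrable
    `[k%:R / n%:R, k.+1%:R / n%:R[ (EFin \o G).
  by apply: integrableS (iGk _ kn).
set I := (`[k%:R / n%:R, k.+1%:R / n%:R[) in iGkk *.
have muI : fine (@lebesgue_measure R [set` I]) = n%:R^-1.
  rewrite lebesgue_measure_itv /= lte_fin ltr_pM2r ?invr_gt0 // ltr_nat leqnn.
  by rewrite -EFinB /= -mulrBl -natrB // subSnn mul1r.
have icst (r : R) : (@lebesgue_measure R).-integrable [set` I] (EFin \o cst r).
  suff ic : (@lebesgue_measure R).-integrable
      `[k%:R / n%:R, k.+1%:R / n%:R] (EFin \o cst r).
    by apply: integrableS ic => //; apply: subset_itvl; rewrite bnd_simp.
  apply: continuous_compact_integrable; first exact: segment_compact.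
  by apply: continuous_subspaceT => u; exact: cvg_cst.
have -> : `[(0:R), k.+1%:R / n%:R[%classic =
    `[0, k%:R / n%:R[%classic `|` [set` I].
  by rewrite -itv_bndbnd_setU // bnd_simp.
rewrite Rintegral_setU //; last 2 first.
- by rewrite -itv_bndbnd_setU ?bnd_simp //; exact: iGk.
- apply/disj_setPS => u [/=]; rewrite !in_itv /= => /andP[_ uk] /andP[ku _].
  by move: uk; rewrite ltNge ku.
rewrite big_ord_recr /= mulrDr opprD addrACA.
rewrite -natr1 mulrDl mul1r mulrDl.
apply: (le_trans (ler_normD _ _)); apply: lerD; first exact/IH/ltnW.
have -> : \int[lebesgue_measure]_(u in [set` I]) G u - n%:R^-1 * c k =
    \int[lebesgue_measure]_(u in [set` I]) (G u - c k).
  by rewrite (RintegralB _ iGkk (icst (c k))) // Rintegral_cst // muI mulrC.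
have iGc : (@lebesgue_measure R).-integrable [set` I]
    (EFin \o (fun u => G u - c k)).
  by apply: integrable_EFinB => //; exact: icst.
apply: le_trans (le_normr_Rintegral _ iGc) _ => //.
rewrite mulrC -muI -Rintegral_cst //; apply: le_Rintegral => //.
- exact: (integrable_norm iGc).
- exact: icst.
- by move=> u; rewrite /= in_itv /= => /andP[ku /ltW]; exact: GB.
Qed.

(** * Lipschitz test functions *)

(** The constant is kept explicit because a recursive call on a sublist of size L multiplies it by
    L/n, the contraction that closes the induction. *)
Definition lipschitz_by {R : realType} (K : R) (h : R -> R) :=
  forall x y, `|h y - h x| <= K * `|y - x|.

(** With [p] = L/n and [q] = -1/n this is the test function seen by the recursive call, since W_n =
    (L/n)(W_L + 1) - 1/n. *)
Lemma lipschitz_by_affine (R : realType) (K p q : R) (h : R -> R) :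
  lipschitz_by K h ->
  lipschitz_by (K * `|p|) (fun x => h (p * (x + 1) + q)).
Proof.
move=> hK x y; apply: le_trans (hK _ _) _.
rewrite (_ : p * (y + 1) + q - (p * (x + 1) + q) = p * (y - x)); last by ring.
by rewrite normrM mulrA.
Qed.

Lemma lipschitz_by_continuous (R : realType) (K : R) (h : R -> R) :
  0 <= K -> lipschitz_by K h -> continuous h.
Proof.
move=> K0 hK x; apply/cvgrPdist_le => e e0; near=> y.
rewrite (le_trans (hK _ _)) // (@le_trans _ _ ((K + 1) * `|x - y|)) //.
  by rewrite ler_wpM2r // lerDl.
rewrite mulrC -ler_pdivlMr ?ltr_wpDl //.
near: y; apply: cvgr_dist_le => //.
by rewrite divr_gt0 // ltr_wpDl.
Unshelve. all: by end_near. Qed.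

Lemma lipschitz_by_integrable (R : realType) (mu : probability R R) (K : R)
    (h : R -> R) :
  mu.-integrable setT (EFin \o id) -> 0 <= K -> lipschitz_by K h ->
  mu.-integrable setT (EFin \o h).
Proof.
move=> imu K0 hK.
have mh : measurable_fun setT h.
  exact: continuous_measurable_fun (lipschitz_by_continuous _ _ _ K0 hK).
(* A Lipschitz function grows at most linearly, so the finite mean of [mu] dominates it. *)
have ig : mu.-integrable setT (fun x => (`|h 0| + K * `|x|)%:E).
  apply: integrable_EFinD => //; first exact: finite_measure_integrable_cst.
  by apply: integrable_EFinZ => //; exact: integrable_norm imu.
apply: le_integrable ig => //.
  exact/measurable_EFinP.
move=> x _; rewrite /= lee_fin (ger0_norm (addr_ge0 _ (mulr_ge0 K0 _))) //.
have := hK 0 x; rewrite subr0 => h0x.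
by rewrite -[h x](subrK (h 0)) addrC (le_trans (ler_normD _ _)) // lerD2l.
Qed.

(** * Harmonic numbers *)

(** [series harmonic L] has L terms, so it is H_L with H_0 = 0. The term [- n%:R] is what later
    absorbs the one-step coupling error. *)
Lemma sum_series_harmonic (R : realType) (n : nat) :
  \sum_(L < n) series (@harmonic R) L = n%:R * series harmonic n - n%:R.
Proof.
elim: n => [|n IH]; first by rewrite big_ord0 mul0r subrr.
have -> : series (@harmonic R) n.+1 = series harmonic n + n.+1%:R^-1.
  by rewrite /series /= big_nat_recr.
rewrite big_ord_recr /= IH mulrDr divff ?pnatr_eq0 // -natr1; ring.
Qed.

(** Each increment 1/(n+2) is at most ln((n+2)/(n+1)), by ln(1 + x) <= x at x = -1/(n+2). *)
Lemma series_harmonic_le (R : realType) (n : nat) :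
  series (@harmonic R) n.+1 <= 1 + ln n.+1%:R.
Proof.
elim: n => [|n IH].
  by rewrite /series /= big_nat1 /= invr1 ln1 addr0.
have -> : series (@harmonic R) n.+2 = series harmonic n.+1 + n.+2%:R^-1.
  by rewrite /series /= big_nat_recr.
suff lnS : n.+2%:R^-1 <= ln n.+2%:R - ln n.+1%:R :> R.
  by apply: le_trans (lerD IH lnS) _; rewrite -addrA lerD2l addrC subrK.
rewrite -ln_div ?posrE // -[leLHS]opprK lerNl -lnV ?posrE ?divr_gt0 //.
have -> : (n.+2%:R / n.+1%:R)^-1 = 1 + - n.+2%:R^-1 :> R.
  rewrite -[n.+2%:R]natr1; have : 0 < n.+1%:R :> R by [].
  move: (n.+1%:R) => a a0; field.
  by rewrite !gt_eqF // addr_gt0.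
by apply: le_ln1Dx; rewrite ltrN2 invf_lt1 // ltr1n.
Qed.

(** * Quickselect compared with the Dickman law *)

Section quickselect_dickman.
Context (R : realType) (mu : probability R R).
Hypothesis mu_dickman : is_dickman mu.

(** On a cell, replacing [u] by L/n moves the argument by at most (|x| + 1)/n and the shift by
    another 1/n. Averaging K(|x| + 2)/n with E|D| <= 1 produces the constant 3. *)
Lemma dickman_step_approx (K : R) (h : R -> R) (n : nat) :
  (0 < n)%N -> 0 <= K -> lipschitz_by K h ->
  `|\int[mu]_x h x
    - n%:R^-1 * \sum_(L < n) \int[mu]_x h (L%:R / n%:R * (x + 1) + - n%:R^-1)|
  <= 3 * K / n%:R.
Proof.
move=> n0 K0 hK; have n0' : 0 < n%:R :> R by rewrite ltr0n.
have imu := dickman_integrable R mu mu_dickman.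
have iaff p q : mu.-integrable setT (fun x => (h (p * (x + 1) + q))%:E).
  apply: (@lipschitz_by_integrable _ _ (K * `|p|)) => //; last first.
    exact: lipschitz_by_affine.
  by rewrite mulr_ge0.
have ih u : mu.-integrable setT (fun x => (h (u * (x + 1)))%:E).
  by apply: eq_integrable (iaff u 0) => // x _; rewrite addr0.
have [iG ->] := dickman_fixpoint R mu mu_dickman h
  (lipschitz_by_integrable _ _ _ _ imu K0 hK) ih.
apply: (Rintegral_step_approx R (fun u => \int[mu]_x h (u * (x + 1)))
  (fun L => \int[mu]_x h (L%:R / n%:R * (x + 1) + - n%:R^-1))) => // L u Lu uL.
have idiff : mu.-integrable setT (EFin \o (fun x =>
    h (u * (x + 1)) - h (L%:R / n%:R * (x + 1) + - n%:R^-1))).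
  by apply: integrable_EFinB => //; [exact: ih|exact: iaff].
rewrite -RintegralB //; [|exact: ih|exact: iaff].
apply: le_trans (le_normr_Rintegral _ idiff) _ => //.
have inorm : mu.-integrable setT (EFin \o (fun x : R => `|x|)).
  exact: integrable_norm imu.
have i2 : mu.-integrable setT (EFin \o cst (2 : R)).
  exact: finite_measure_integrable_cst.
have inorm2 : mu.-integrable setT (EFin \o (fun x : R => `|x| + 2)).
  exact: integrable_EFinD.
apply: (@le_trans _ _ (\int[mu]_x (K / n%:R * (`|x| + 2)))).
  apply: le_Rintegral => //.
  - exact: integrable_norm idiff.
  - exact: integrable_EFinZ.
  move=> x _; apply: le_trans (hK _ _) _; rewrite -[leRHS]mulrA ler_wpM2l //.
  have -> : u * (x + 1) - (L%:R / n%:R * (x + 1) + - n%:R^-1) =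
    (u - L%:R / n%:R) * (x + 1) + n%:R^-1 by ring.
  have uLn : `|u - L%:R / n%:R| <= n%:R^-1.
    rewrite ger0_norm ?subr_ge0 // lerBlDl (le_trans uL) //.
    by rewrite -natr1 mulrDl mul1r.
  apply: le_trans (ler_normD _ _) _.
  rewrite normrM [`|n%:R^-1|]ger0_norm ?invr_ge0 //.
  rewrite (_ : n%:R^-1 * (`|x| + 2) = n%:R^-1 * (`|x| + 1) + n%:R^-1); last by ring.
  by rewrite lerD2r ler_pM // -[X in _ <= _ + X](@normr1 R) ler_normD.
rewrite RintegralZl // (RintegralD _ inorm i2) // Rintegral_probability_cst.
rewrite (_ : 3 * K / n%:R = K / n%:R * 3); last by ring.
rewrite ler_wpM2l ?divr_ge0 //.
have := dickman_mean_le1 R mu mu_dickman; lra.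
Qed.

(** Induction on [fuel] with [K] and [h] general, as both change in the recursive call. For m = 1
    only stopping (L = 0) and the left sublist occur. *)
Lemma quickselect_dickman (fuel n : nat) (K : R) (h : R -> R) :
  (n <= fuel)%N -> (0 < n)%N -> 0 <= K -> lipschitz_by K h ->
  `|qs_exp_fuel fuel n 1 (fun c => h (c%:R / n%:R - 1)) - \int[mu]_x h x|
    <= 3 * K / n%:R * series harmonic n.
Proof.
elim: fuel n K h => [|fuel IH] n K h; first by rewrite leqn0 => /eqP ->.
move=> nfuel n0 K0 hK; have n0' : 0 < n%:R :> R by rewrite ltr0n.
rewrite [qs_exp_fuel _ _ _ _]/=; set T := BIG_F.
pose c L := \int[mu]_x h (L%:R / n%:R * (x + 1) + - n%:R^-1).
have Tc (L : 'I_n) : `|T L - c L| <= 3 * K / n%:R * series harmonic L.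
  have nE : n%:R = n.-1%:R + 1 :> R by rewrite natr1 prednK.
  (* When L = 0 both [T L] and [c L] are h(-1/n), so the error is 0, matching H_0 = 0. *)
  rewrite /T; case: eqP => [L0|/eqP]; last rewrite -lt0n => L0.
    rewrite /c L0 /series /= big_nil mulr0 mul0r.
    under eq_Rintegral do rewrite mul0r add0r.
    rewrite Rintegral_probability_cst (_ : _ / _ - 1 = - n%:R^-1) ?subrr ?normr0 //.
    by rewrite nE; field; rewrite -nE gt_eqF.
  rewrite L0; have L0' : 0 < L%:R :> R by rewrite ltr0n.
  (* The Lipschitz constant K L/n cancels the 1/L of the inductive bound, leaving 3K/n times H_L. *)
  have := IH L (K * `|L%:R / n%:R|) _ _ L0 _ (lipschitz_by_affine _ _ _ (- n%:R^-1) _ hK).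
  rewrite ger0_norm ?divr_ge0 //.
  rewrite (_ : (fun c => _) = (fun c => h ((c + n.-1)%:R / n%:R - 1))); last first.
    apply/funext => k; congr h; rewrite natrD nE; field.
    by rewrite -nE !gt_eqF.
  rewrite (_ : 3 * (K * (L%:R / n%:R)) / L%:R = 3 * K / n%:R); last first.
    by field; rewrite !gt_eqF.
  apply; last by rewrite mulr_ge0 // divr_ge0.
  by rewrite -ltnS (leq_trans (ltn_ord L)).
have step := dickman_step_approx _ _ _ n0 K0 hK.
have := sum_series_harmonic R n.
set S := series harmonic n => SE.
have stepT : `|n%:R^-1 * (\sum_(L < n) T L) - n%:R^-1 * \sum_(L < n) c L|
    <= n%:R^-1 * \sum_(L < n) 3 * K / n%:R * series harmonic L.
  rewrite -mulrBr -sumrB normrM ger0_norm ?invr_ge0 //.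
  rewrite ler_wpM2l ?invr_ge0 //.
  by apply: le_trans (ler_norm_sum _ _ _) _; apply: ler_sum => L _; exact: Tc.
apply: le_trans (ler_distD (n%:R^-1 * \sum_(L < n) c L) _ _) _.
apply: le_trans (lerD stepT _) _; first by rewrite distrC; exact: step.
(* Equality holds: averaging the recursive errors gives (3K/n)(H_n - 1), and the one-step error 3K/n
   supplies the missing 1. *)
rewrite -mulr_sumr SE le_eqVlt; apply/orP; left; apply/eqP.
by field; rewrite gt_eqF.
Qed.

End quickselect_dickman.

Theorem theorem1p1 (R : realType) (mu : probability R R) (n : nat) :
  is_dickman mu -> (1 <= n)%N ->
  forall h : R -> R, lip1 h ->
  (`| (qs_exp n 1 (fun c => h (c%:R / n%:R - 1)))%:E - \int[mu]_x (h x)%:E |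
     <= ((8 * ln (n%:R / 2) + 10) / n%:R)%:E)%E.
Proof.
move=> mu_dickman n1 h h1.
have hK : lipschitz_by 1 h by move=> x y; rewrite mul1r.
have ih := lipschitz_by_integrable _ _ _ _
  (dickman_integrable R mu mu_dickman) ler01 hK.
rewrite -(fineK (integrable_fin_num _ ih)) // -EFinB abse_EFin lee_fin.
apply: le_trans (quickselect_dickman _ _ mu_dickman _ _ _ _ (leqnn n) n1 ler01 hK) _.
have n0 : 0 < n%:R :> R by rewrite ltr0n.
rewrite mulr1 mulrAC ler_pM2r ?invr_gt0 //.
have Hn : series (@harmonic R) n <= 1 + ln n%:R.
  by rewrite -(prednK n1); exact: series_harmonic_le.
have lnn : 0 <= ln n%:R :> R by rewrite ln_ge0 // ler1n.
(* The claim reduces to 8 ln 2 <= 5 ln n + 7, for which ln 2 <= 7/8 is enough. A single use of ln(1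
   + x) <= x gives only 1; splitting 2 as (4/3)(3/2) gives 1/3 + 1/2. *)
have ln2 : ln 2 <= 5 / 6 :> R.
  have -> : 2 = (1 + 1 / 3) * (1 + 1 / 2) :> R by field.
  rewrite lnM ?posrE; [|lra|lra].
  have := @le_ln1Dx R (1 / 3); have := @le_ln1Dx R (1 / 2); lra.
rewrite ln_div ?posrE //; lra.
Qed.
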